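(* Let $\mathbb{F}$ be a finite field, let $\delta,k,n$ be positive integers with $k<n$, and let $\Sigma=(A,B,C,D)$ with $A\in\mathbb{F}^{\delta\times\delta}$, $B\in\mathbb{F}^{\delta\times k}$, $C\in\mathbb{F}^{(n-k)\times\delta}$, $D\in\mathbb{F}^{(n-k)\times k}$ be a minimal and observable I/S/O representation of an observable $(n,k,\delta)$-convolutional code $\mathcal{C}$ over $\mathbb{F}$. Let $S\in\mathbb{F}^{\delta\times\delta}$, $Q\in\mathbb{F}^{k\times k}$, $H\in\mathbb{F}^{(n-k)\times(n-k)}$ be invertible matrices and put $\Sigma_1=(S^{-1}AS,S^{-1}B,CS,D)$, $\Sigma_2=(A,BQ,C,DQ)$, $\Sigma_3=(A,B,H^{-1}C,H^{-1}D)$. Then for each $i=1,2,3$, $\Sigma_i$ is an observable I/S/O representation of the convolutional code $\mathcal{C}_i:=\mathcal{C}(\Sigma_i)$ over $\mathbb{F}$, and $\mathcal{C}_i$ is an observable convolutional code.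
   Context: An $(n,k)$-convolutional code over $\mathbb{F}$ is an $\mathbb{F}[z]$-submodule $\mathcal{C}\subseteq\mathbb{F}[z]^n$ of rank $k$ (automatically free). An encoder of $\mathcal{C}$ is a matrix $G(z)\in\mathbb{F}[z]^{n\times k}$ whose columns form an $\mathbb{F}[z]$-basis of $\mathcal{C}$. The degree (complexity) $\delta$ of $\mathcal{C}$ is the highest degree of the $k\times k$ minors of an encoder (this does not depend on the encoder); then $\mathcal{C}$ is called an $(n,k,\delta)$-convolutional code. The code $\mathcal{C}$ with encoder $G(z)$ is observable if there is a surjective $\mathbb{F}[z]$-linear map $\psi:\mathbb{F}[z]^n\to\mathbb{F}[z]^{n-k}$ such that $0\to\mathbb{F}[z]^k\xrightarrow{G(z)}\mathbb{F}[z]^n\xrightarrow{\psi}\mathbb{F}[z]^{n-k}\to0$ is exact. For a tuple $\Sigma=(A,B,C,D)$ with $A\in\mathbb{F}^{\delta\times\delta}$, $B\in\mathbb{F}^{\delta\times k}$, $C\in\mathbb{F}^{(n-k)\times\delta}$, $D\in\mathbb{F}^{(n-k)\times k}$, let $\mathcal{C}(\Sigma)$ be the set of finite-support trajectories $v_t=\begin{pmatrix} y_t \\ u_t \end{pmatrix}$ of the system $x_{t+1}=Ax_t+Bu_t$, $y_t=Cx_t+Du_t$, $x_0=0$, with finite-support state. In polynomial form, $$\mathcal{C}(\Sigma)=\left\{\begin{pmatrix} y(z) \\ u(z) \end{pmatrix}\in\mathbb{F}[z]^n:\ \exists\,x(z)\in\mathbb{F}[z]^\delta,\ (zI-A)x(z)=Bu(z),\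 y(z)=Cx(z)+Du(z)\right\}$$ (equivalently $zKx+Lx+Mv=0$ with $K=\begin{pmatrix} -I_\delta \\ 0 \end{pmatrix}$, $L=\begin{pmatrix} A \\ C \end{pmatrix}$, $M=\begin{pmatrix} 0&B \\ -I_{n-k}&D \end{pmatrix}$; here time sequences are encoded as $x(z)=x_0z^\gamma+x_1z^{\gamma-1}+\dots+x_\gamma$, and similarly for $u,y$). $\Sigma$ is an I/S/O representation of an $(n,k,\delta)$-convolutional code $\mathcal{C}$ if $\mathcal{C}=\mathcal{C}(\Sigma)$, where $\delta$ is the size of $A$. It is minimal if $\Sigma$ is reachable, i.e. $\begin{pmatrix}B&AB&\cdots&A^{\delta-1}B\end{pmatrix}$ has rank $\delta$. It is observable if $\begin{pmatrix} C \\ C A \\ \vdots \\ C A^{\delta-1} \end{pmatrix}$ has rank $\delta$. *)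

(* Defs.v *)
From HB Require Import structures.
From mathcomp Require Import all_boot all_order all_algebra.
From mathcomp Require Import boolp classical_sets functions.

Set Implicit Arguments.
Unset Strict Implicit.
Unset Printing Implicit Defensive.

Import GRing.Theory.
Local Open Scope ring_scope.
Local Open Scope classical_set_scope.

Section ConvolutionalCodes.
Variables (F : fieldType) (n : nat).
Implicit Types (k d : nat) (C : set 'cV[{poly F}]_n).

Definition is_submodule C : Prop :=
  C 0 /\ forall (a : {poly F}) (v w : 'cV[{poly F}]_n),
    C v -> C w -> C (a *: v + w).

Definition columns_independent k (G : 'M[{poly F}]_(n, k)) : Prop :=
  forall a : 'cV[{poly F}]_k, G *m a = 0 -> a = 0.

(* The rank of a module over the domain F[z]: the maximal number of linearly
   independent elements. *)
Definition has_rank C k : Prop :=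
  (exists G : 'M[{poly F}]_(n, k),
     (forall j, C (col j G)) /\ columns_independent G) /\
  (forall G : 'M[{poly F}]_(n, k.+1),
     (forall j, C (col j G)) -> ~ columns_independent G).

Definition is_encoder k (G : 'M[{poly F}]_(n, k)) C : Prop :=
  C = range (fun a : 'cV[{poly F}]_k => G *m a) /\ columns_independent G.

(* The k x k minors are indexed by the increasing choices of k rows. The
   truncated predecessor gives a vanishing minor degree 0, which does not
   affect the maximum when G is an encoder, as some minor is then nonzero. *)
Definition max_minor_degree k (G : 'M[{poly F}]_(n, k)) : nat :=
  \max_(f : {ffun 'I_k -> 'I_n} |
         [forall i : 'I_k, forall j : 'I_k, (i < j)%N ==> (f i < f j)%N])
    (size (\det (rowsub f G))).-1.

(* The degree does not depend on the encoder. *)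
Definition has_degree C k d : Prop :=
  exists2 G : 'M[{poly F}]_(n, k), is_encoder G C & max_minor_degree G = d.

Definition convolutional_code k d C : Prop :=
  [/\ is_submodule C, has_rank C k & has_degree C k d].

(* Exactness of 0 -> F[z]^k -> F[z]^n -> F[z]^(n-k) -> 0, with maps G and psi. *)
Definition short_exact k (G : 'M[{poly F}]_(n, k))
    (psi : {linear 'cV[{poly F}]_n -> 'cV[{poly F}]_(n - k)}) : Prop :=
  [/\ injective (fun a : 'cV[{poly F}]_k => G *m a),
      range (fun a : 'cV[{poly F}]_k => G *m a) = [set v | psi v = 0] &
      range psi = setT].

(* This depends only on the code: two encoders have the same range. *)
Definition observable_code k C : Prop :=
  exists2 G : 'M[{poly F}]_(n, k), is_encoder G C &
    exists psi : {linear 'cV[{poly F}]_n -> 'cV[{poly F}]_(n - k)},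
      short_exact G psi.

End ConvolutionalCodes.

Record iso_system (F : fieldType) (d k p : nat) := ISOSystem {
  iso_A : 'M[F]_d;
  iso_B : 'M[F]_(d, k);
  iso_C : 'M[F]_(p, d);
  iso_D : 'M[F]_(p, k)
}.

Section Systems.
Variables (F : fieldType) (d k p : nat).
Implicit Type Sigma : iso_system F d k p.

(* The equation p + k = n transports the column (y; u) of height p + k to
   F[z]^n; in use p is n - k. *)
Definition code_of n (e : (p + k)%N = n) Sigma : set 'cV[{poly F}]_n :=
  let A := map_mx polyC (iso_A Sigma) in
  let B := map_mx polyC (iso_B Sigma) in
  let C := map_mx polyC (iso_C Sigma) in
  let D := map_mx polyC (iso_D Sigma) in
  [set v | exists (y : 'cV[{poly F}]_p) (u : 'cV[{poly F}]_k),
     v = castmx (e, erefl 1%N) (col_mx y u) /\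
     exists x : 'cV[{poly F}]_d,
       ('X%:M - A) *m x = B *m u /\ y = C *m x + D *m u].

Definition iso_representation n (e : (p + k)%N = n) Sigma
    (C : set 'cV[{poly F}]_n) : Prop :=
  convolutional_code k d C /\ C = code_of e Sigma.

Definition reachable Sigma : Prop :=
  \rank (\mxrow_(i < d) (iso_A Sigma ^+ i *m iso_B Sigma)) = d.

Definition minimal Sigma : Prop := reachable Sigma.

Definition observable_system Sigma : Prop :=
  \rank (\mxcol_(i < d) (iso_C Sigma *m iso_A Sigma ^+ i)) = d.

End Systems.

(* Main.v *)
Require Import Defs.
From HB Require Import structures.
From mathcomp Require Import all_boot all_order all_algebra all_fingroup.
From mathcomp Require Import boolp classical_sets functions.

Set Implicit Arguments.
Unset Strict Implicit.
Unset Printing Implicit Defensive.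

Import GRing.Theory.
Local Open Scope ring_scope.
Local Open Scope classical_set_scope.

(* Replacing (x, y, u) by (S^-1 x, H^-1 y, Q^-1 u) turns trajectories of
   (A, B, C, D) into trajectories of
   (S^-1 A S, S^-1 B Q, H^-1 C S, H^-1 D Q), so the code of the latter is the
   image of the original one under the constant invertible matrix
   P = diag(H^-1, Q^-1).  Such an image is again an observable code of the same
   rank; its degree is the same because the minors of P G are F-linear
   combinations of the minors of G (Cauchy-Binet), so left multiplication by
   the constant matrices P and P^-1 cannot raise the degree.  The three systems
   are the cases where two of S, Q, H are the identity. *)

(** Cauchy-Binet before grouping: the rows of [M *m N] are combinations of the rows of [N], and the
    determinant is multilinear in rows. As [g] runs over all maps, no signs have to be collected. *)
Lemma det_mulmx_rowsub (R : comPzRingType) (m n : nat)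
    (M : 'M[R]_(m, n)) (N : 'M[R]_(n, m)) :
  \det (M *m N) =
    \sum_(g : {ffun 'I_m -> 'I_n}) (\prod_i M i (g i)) * \det (rowsub g N).
Proof.
transitivity (\sum_(s : 'S_m) \sum_(g : {ffun 'I_m -> 'I_n})
    (-1) ^+ s * \prod_i (M i (g i) * N (g i) (s i))).
  apply: eq_bigr => /= s _; rewrite -big_distrr /=; congr (_ * _).
  rewrite -(bigA_distr_bigA (fun i j => M i j * N j (s i))) /=.
  by apply: eq_bigr => i _; rewrite mxE.
rewrite exchange_big; apply: eq_bigr => /= g _.
rewrite big_distrr /=; apply: eq_bigr => s _.
rewrite mulrCA big_split /=; congr (_ * (_ * _)).
by apply: eq_bigr => i _; rewrite mxE.
Qed.

(** [f] lists the image of [g] increasingly and [s] sends [i] to the position of [g i] in that list.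
    This reduces arbitrary row selections to the increasing ones of [max_minor_degree]. *)
Lemma sorted_rearrangement (m n : nat) (g : 'I_m -> 'I_n) :
  injective g ->
  exists (f : {ffun 'I_m -> 'I_n}) (s : 'S_m),
    {homo f : i j / (i < j)%N} /\ g =1 f \o s.
Proof.
move=> g_inj; pose t := sort (fun i j : 'I_n => (i <= j)%N) (codom g).
have size_t : size t = m by rewrite size_sort size_codom card_ord.
have uniq_t : uniq t by rewrite sort_uniq map_inj_uniq // enum_uniq.
have ind_lt i : (index (g i) t < m)%N.
  by rewrite -[X in (_ < X)%N]size_t index_mem mem_sort codom_f.
have s_inj : injective (fun i => Ordinal (ind_lt i)).
  move=> i j /(congr1 val) /= eq_ij; apply: g_inj.
  have g_t l : g l \in t by rewrite mem_sort codom_f.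
  by rewrite -(nth_index (g i) (g_t i)) eq_ij nth_index.
(* [nth] needs a default value in ['I_n]; [g ord0] provides one only when the domain is nonempty. *)
case: m => [|m] in g g_inj t size_t uniq_t ind_lt s_inj *.
  exists [ffun i => g i], 1%g; split=> [[]|[]] //.
exists [ffun i : 'I_m.+1 => nth (g ord0) t i], (perm s_inj); split=> [i j ij|i].
  rewrite !ffunE ltn_neqAle; apply/andP; split.
    by rewrite (inj_eq val_inj) nth_uniq ?size_t // neq_ltn ij.
  apply: (@sorted_leq_nth _ (fun i j : 'I_n => (i <= j)%N)) => //.
  - by move=> ? ? ?; apply: leq_trans.
  - by apply: sort_sorted => ? ?; apply: leq_total.
  - by rewrite inE size_t.
  - by rewrite inE size_t.
  - exact: ltnW.
by rewrite /= ffunE permE /= nth_index // mem_sort codom_f.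
Qed.

(** * Images of codes under constant invertible matrices *)

Section CodeTransport.
Variables (F : fieldType) (n : nat).
Implicit Types (k d : nat) (P : 'M[F]_n) (code : set 'cV[{poly F}]_n).

(** A repeated row makes the determinant vanish; otherwise sorting the rows changes only its
    sign. *)
Lemma size_minor_le k (G : 'M[{poly F}]_(n, k)) (g : 'I_k -> 'I_n) :
  (size (\det (rowsub g G)) <= (max_minor_degree G).+1)%N.
Proof.
have [g_inj|g_ninj] := boolP (injectiveb g); last first.
  have /injectivePn[i [j ij gij]] := g_ninj.
  rewrite (determinant_alternate ij) ?size_poly0 // => l.
  by rewrite !mxE gij.
have [f [s [f_mono gE]]] := sorted_rearrangement (injectiveP _ g_inj).
have -> : rowsub g G = row_perm s (rowsub f G).
  by apply/matrixP=> i j; rewrite !mxE gE.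
rewrite row_permE det_mulmx det_perm -signr_odd.
have -> : size ((-1) ^+ (odd s) * \det (rowsub f G)) = size (\det (rowsub f G)).
  by case: (odd s); rewrite ?mulN1r ?size_polyN ?mul1r.
rewrite -add1n -leq_subLR subn1.
apply: (@leq_bigmax_cond _ _
  (fun f : {ffun 'I_k -> 'I_n} => (size (\det (rowsub f G))).-1)).
by apply/forallP=> i; apply/forallP=> j; apply/implyP; apply: f_mono.
Qed.

Lemma max_minor_degree_le_mulmx k P (G : 'M[{poly F}]_(n, k)) :
  (max_minor_degree (map_mx polyC P *m G) <= max_minor_degree G)%N.
Proof.
apply/bigmax_leqP => f _; rewrite -subn1 leq_subLR add1n -mul_rowsub_mx det_mulmx_rowsub.
apply: (leq_trans (size_sum _ _ _)); apply/bigmax_leqP => g _.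
(* The coefficients are constant polynomials, so they cannot raise the degree of a minor of [G]. *)
have -> : \prod_i rowsub f (map_mx polyC P) i (g i) = (\prod_i P (f i) (g i))%:P.
  by rewrite rmorph_prod; apply: eq_bigr => i _; rewrite !mxE.
by rewrite mul_polyC; apply: leq_trans (size_scale_leq _ _) (size_minor_le _ _).
Qed.

Variables (P : 'M[F]_n).
Hypothesis P_unit : P \in unitmx.
Let Pz := map_mx polyC P.
Let Pz' := map_mx polyC (invmx P).

Let PzK m (M : 'M_(n, m)) : Pz' *m (Pz *m M) = M.
Proof. by rewrite mulmxA -map_mxM mulVmx // map_mx1 mul1mx. Qed.

Let PzVK m (M : 'M_(n, m)) : Pz *m (Pz' *m M) = M.
Proof. by rewrite mulmxA -map_mxM mulmxV // map_mx1 mul1mx. Qed.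

Let independent_mulmx k (G : 'M_(n, k)) :
  columns_independent (Pz *m G) <-> columns_independent G.
Proof.
split=> indG a.
  by move=> Ga0; apply: indG; rewrite -mulmxA Ga0 mulmx0.
by rewrite -mulmxA => /(congr1 (mulmx Pz')); rewrite PzK mulmx0; apply: indG.
Qed.

Lemma is_encoder_mulmx k (G : 'M_(n, k)) code :
  is_encoder G code -> is_encoder (Pz *m G) (mulmx Pz @` code).
Proof.
move=> [-> indG]; split; last exact/independent_mulmx.
by rewrite image_comp; congr (_ @` _); apply/funext=> a /=; rewrite mulmxA.
Qed.

Lemma max_minor_degree_mulmx k (G : 'M_(n, k)) :
  max_minor_degree (Pz *m G) = max_minor_degree G.
Proof.
apply/eqP; rewrite eqn_leq max_minor_degree_le_mulmx /=.
(* The same bound, for [invmx P] acting on [Pz *m G]. *)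
by rewrite -{1}[G]PzK max_minor_degree_le_mulmx.
Qed.

(** Multiplication by [Pz] is an F[z]-linear bijection, which settles the submodule and rank
    conditions; the degree condition rests on [P] being constant. *)
Lemma convolutional_code_mulmx k d code :
  convolutional_code k d code ->
  convolutional_code k d (mulmx Pz @` code).
Proof.
move=> [[code0 code_lin] [[G [codeG indG]] max_rank] [E encE degE]]; split.
- split; first by exists 0 => //; rewrite mulmx0.
  move=> a _ _ [v code_v <-] [w code_w <-].
  exists (a *: v + w); first exact: code_lin.
  by rewrite mulmxDr scalemxAr.
- split.
    exists (Pz *m G); split; last exact/independent_mulmx.
    by move=> j; exists (col j G) => //; rewrite !colE mulmxA.
  (* Too large an independent family in the image would pull back to one in [code]. *)
  move=> G' codeG' indG'; apply: (max_rank (Pz' *m G')).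
    move=> j; have [v code_v Pv] := codeG' j.
    by rewrite colE -mulmxA -colE -Pv PzK.
  by apply/independent_mulmx; rewrite PzVK.
- exists (Pz *m E); first exact: is_encoder_mulmx.
  by rewrite max_minor_degree_mulmx.
Qed.

Lemma observable_code_mulmx k code :
  observable_code k code -> observable_code k (mulmx Pz @` code).
Proof.
move=> [G encG [psi [G_inj G_ker psi_surj]]].
exists (Pz *m G); first exact: is_encoder_mulmx.
(* The kernel of this map is the image under [Pz] of the kernel of [psi], that is, the range of
   [Pz *m G]. *)
exists (psi \o mulmx Pz'); split.
- move=> a b /=; rewrite -!mulmxA => /(congr1 (mulmx Pz')).
  by rewrite !PzK; apply: G_inj.
- apply/seteqP; split=> [_ [a _ <-] /=|v /= v_ker].
    have : [set v | psi v = 0] (G *m a) by rewrite -G_ker; exists a.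
    by rewrite -mulmxA PzK.
  have : [set v | psi v = 0] (Pz' *m v) by [].
  by rewrite -G_ker => -[a _ Ga]; exists a => //; rewrite -mulmxA Ga PzVK.
- apply/seteqP; split=> // w _.
  have : range psi w by rewrite psi_surj.
  by move=> [v _ <-]; exists (Pz *m v) => //=; rewrite PzK.
Qed.

End CodeTransport.

(** * Trajectories under linear maps of states, inputs and outputs *)

Section SystemTransport.
Variables (F : fieldType) (d k p n : nat) (e : (p + k)%N = n).
Implicit Types Sigma : iso_system F d k p.

(** Acts on (y; u) by [V] on outputs and [U] on inputs, cast along [e] to match the vectors of
    [code_of]. *)
Definition output_input_mx (V : 'M[F]_p) (U : 'M[F]_k) : 'M[F]_n :=
  castmx (e, e) (block_mx V 0 0 U).

Lemma output_input_mx_mul V U V' U' :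
  output_input_mx V U *m output_input_mx V' U' =
    output_input_mx (V *m V') (U *m U').
Proof.
rewrite /output_input_mx; case: _ / e; rewrite !castmx_id mulmx_block.
by rewrite !mulmx0 !mul0mx !addr0 !add0r.
Qed.

Lemma output_input_mx1 : output_input_mx 1%:M 1%:M = 1%:M.
Proof.
by rewrite /output_input_mx; case: _ / e; rewrite castmx_id -scalar_mx_block.
Qed.

(** The maps [T], [V], [U] on states, outputs and inputs send trajectories to trajectories.
    Intertwining relations, free of inverses, let the lemma serve both inclusions of
    [code_of_transformed]. *)
Lemma code_of_intertwined (T : 'M[F]_d) (U : 'M[F]_k) (V : 'M[F]_p)
    (A A' : 'M[F]_d) B B' C C' D D' :
  T *m A = A' *m T -> T *m B = B' *m U ->
  V *m C = C' *m T -> V *m D = D' *m U ->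
  forall v, code_of e (ISOSystem A B C D) v ->
    code_of e (ISOSystem A' B' C' D')
      (map_mx polyC (output_input_mx V U) *m v).
Proof.
move=> TA TB VC VD v [y [u [-> [x [xE ->]]]]].
move: xE; rewrite /= => xE.
exists (map_mx polyC V *m (map_mx polyC C *m x + map_mx polyC D *m u)).
exists (map_mx polyC U *m u); split.
  rewrite /output_input_mx; case: _ / e; rewrite !castmx_id map_block_mx.
  by rewrite mul_block_col !map_mx0 !mul0mx addr0 add0r.
(* (zI - A')Tx = T(zI - A)x = TBu = B'Uu. *)
exists (map_mx polyC T *m x); split=> /=.
  rewrite [RHS]mulmxA -map_mxM -TB map_mxM -mulmxA -xE.
  rewrite mulmxBl !mulmxA -map_mxM -TA map_mxM.
  by rewrite mulmxBr mulmxBl scalar_mxC.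
by rewrite mulmxDr !mulmxA -!map_mxM VC VD.
Qed.

(** * Simultaneous change of basis in the state, input and output spaces *)

Section Equivalence.
Variables (A : 'M[F]_d) (B : 'M[F]_(d, k)) (C : 'M[F]_(p, d)) (D : 'M[F]_(p, k)).
Variables (S : 'M[F]_d) (Q : 'M[F]_k) (H : 'M[F]_p).
Hypotheses (hS : S \in unitmx) (hQ : Q \in unitmx) (hH : H \in unitmx).

Definition transformed_system :=
  ISOSystem (invmx S *m A *m S) (invmx S *m B *m Q)
            (invmx H *m C *m S) (invmx H *m D *m Q).

Lemma output_input_mx_unit : output_input_mx (invmx H) (invmx Q) \in unitmx.
Proof.
have /mulmx1_unit[] // :
  output_input_mx (invmx H) (invmx Q) *m output_input_mx H Q = 1%:M.
by rewrite output_input_mx_mul !mulVmx // output_input_mx1.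
Qed.

Lemma code_of_transformed :
  code_of e transformed_system =
    mulmx (map_mx polyC (output_input_mx (invmx H) (invmx Q)))
      @` code_of e (ISOSystem A B C D).
Proof.
apply/seteqP; split=> [v code_v|_ [v code_v <-]]; last first.
  move: v code_v; apply: (@code_of_intertwined (invmx S)).
  - by rewrite mulmxK.
  - by rewrite mulmxK.
  - by rewrite mulmxK.
  - by rewrite mulmxK.
(* The inverse transformation is diag(H, Q), with [S] carrying the states back. *)
exists (map_mx polyC (output_input_mx H Q) *m v); last first.
  rewrite mulmxA -map_mxM output_input_mx_mul !mulVmx // output_input_mx1.
  by rewrite map_mx1 mul1mx.
move: v code_v; apply: (@code_of_intertwined S).
- by rewrite !mulmxA mulmxV // mul1mx.
- by rewrite !mulmxA mulmxV // mul1mx.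
- by rewrite !mulmxA mulmxV // mul1mx.
- by rewrite !mulmxA mulmxV // mul1mx.
Qed.

(** The new observability matrix is diag(H^-1, ..., H^-1) O S, with O the old one, and invertible
    factors on either side preserve rank. *)
Lemma observable_transformed :
  observable_system (ISOSystem A B C D) -> observable_system transformed_system.
Proof.
rewrite /observable_system /= => rank_obs.
have conj_exp i : S *m (invmx S *m A *m S) ^+ i = A ^+ i *m S.
  elim: i => [|i IHi]; first by rewrite !expr0 mulmx1 mul1mx.
  by rewrite !exprS -![_ * _]/(_ *m _) !mulmxA mulmxV // mul1mx -mulmxA IHi mulmxA.
have -> : \mxcol_(i < d) (invmx H *m C *m S *m (invmx S *m A *m S) ^+ i)
    = \mxcol_(i < d) (invmx H *m (C *m A ^+ i)) *m S.
  by rewrite mxcol_mul; apply: eq_mxcol => i; rewrite -mulmxA conj_exp !mulmxA.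
rewrite mxrankMfree ?row_free_unit //.
(* There are [d] columns, so only the lower bound remains; it holds because O is recovered by
   multiplying on the left by diag(H, ..., H). *)
apply/eqP; rewrite eqn_leq rank_leq_col /= -[X in (X <= _)%N]rank_obs.
have -> : \mxcol_(i < d) (C *m A ^+ i)
    = \mxdiag_(i < d) H *m \mxcol_(i < d) (invmx H *m (C *m A ^+ i)).
  by rewrite mul_mxdiag_mxcol; apply: eq_mxcol => i; rewrite mulKVmx.
exact: mxrankM_maxr.
Qed.

Lemma transformed_representation (code : set 'cV[{poly F}]_n) :
  iso_representation e (ISOSystem A B C D) code ->
  iso_representation e transformed_system (code_of e transformed_system).
Proof.
move=> [code_conv codeE]; split=> //; rewrite code_of_transformed -codeE.
exact: convolutional_code_mulmx output_input_mx_unit _ _ _ code_conv.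
Qed.

Lemma observable_code_transformed j :
  observable_code j (code_of e (ISOSystem A B C D)) ->
  observable_code j (code_of e transformed_system).
Proof.
rewrite code_of_transformed.
exact: observable_code_mulmx output_input_mx_unit _ _.
Qed.

End Equivalence.
End SystemTransport.

Theorem corollary3p5 (F : finFieldType) (d k n : nat)
    (hd : (0 < d)%N) (hk : (0 < k)%N) (hn : (0 < n)%N) (hkn : (k < n)%N)
    (A : 'M[F]_d) (B : 'M[F]_(d, k))
    (C : 'M[F]_(n - k, d)) (D : 'M[F]_(n - k, k))
    (code : set 'cV[{poly F}]_n)
    (hcode : convolutional_code k d code)
    (hcode_obs : observable_code k code)
    (hrep : iso_representation (subnK (ltnW hkn)) (ISOSystem A B C D) code)
    (hmin : minimal (ISOSystem A B C D))
    (hobs : observable_system (ISOSystem A B C D))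
    (S : 'M[F]_d) (Q : 'M[F]_k) (H : 'M[F]_(n - k))
    (hS : S \in unitmx) (hQ : Q \in unitmx) (hH : H \in unitmx) :
  let Sigma1 := ISOSystem (invmx S *m A *m S) (invmx S *m B) (C *m S) D in
  let Sigma2 := ISOSystem A (B *m Q) C (D *m Q) in
  let Sigma3 := ISOSystem A B (invmx H *m C) (invmx H *m D) in
  let code1 := code_of (subnK (ltnW hkn)) Sigma1 in
  let code2 := code_of (subnK (ltnW hkn)) Sigma2 in
  let code3 := code_of (subnK (ltnW hkn)) Sigma3 in
  [/\ [/\ iso_representation (subnK (ltnW hkn)) Sigma1 code1,
          observable_system Sigma1 & observable_code k code1],
      [/\ iso_representation (subnK (ltnW hkn)) Sigma2 code2,
          observable_system Sigma2 & observable_code k code2] &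
      [/\ iso_representation (subnK (ltnW hkn)) Sigma3 code3,
          observable_system Sigma3 & observable_code k code3]].
Proof.
have main S' Q' H' (hS' : S' \in unitmx) (hQ' : Q' \in unitmx)
    (hH' : H' \in unitmx) (Sigma := transformed_system A B C D S' Q' H') :
    [/\ iso_representation (subnK (ltnW hkn)) Sigma
          (code_of (subnK (ltnW hkn)) Sigma),
        observable_system Sigma &
        observable_code k (code_of (subnK (ltnW hkn)) Sigma)].
  split.
  - exact: transformed_representation hrep.
  - exact: observable_transformed.
  - by apply: observable_code_transformed; rewrite // -hrep.2.
have u1 m : 1%:M \in @unitmx F m := unitmx1 F m.
split.
- by have := main _ _ _ hS (u1 _) (u1 _);
     rewrite /transformed_system ?invmx1 !mul1mx !mulmx1.
- by have := main _ _ _ (u1 _) hQ (u1 _);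
     rewrite /transformed_system ?invmx1 !mul1mx !mulmx1.
- by have := main _ _ _ (u1 _) (u1 _) hH;
     rewrite /transformed_system ?invmx1 !mul1mx !mulmx1.
Qed.
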